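(* As $\min\{m,n\}\to\infty$, \[ z_A(m,n)=\frac{mn}{3}+o(mn), \] uniformly over the aspect ratio (that is, for every $\varepsilon>0$ there is $N$ such that $|z_A(m,n)-mn/3|\le\varepsilon mn$ whenever $\min\{m,n\}\ge N$).
   Context: Let $m,n\ge2$. An $m\times n$ binary matrix is identified with the set of its occupied cells $(r,c)\in[m]\times[n]$ (entries equal to $1$). It is $C_4$-free if it has no all-one $2\times2$ submatrix (two distinct rows, two distinct columns). Choose a $C_4$-free set of fixed cells (a base) $E_1\subseteq[m]\times[n]$ (possibly empty). A selected pair (2-edge) is an unordered pair of distinct cells outside $E_1$. It is nondegenerate if its two cells lie in distinct rows and distinct columns; degenerate pairs (repeated row or repeated column) are also allowed. Given a family $E_2$ of selected pairs, let $O$ be the union of $E_1$ and all cells of pairs in $E_2$. The configuration $(E_1,E_2)$ is admissible if: (S) each cell is used by at most one selected pair; (C2) for each nondegenerate selected pair $((r,c),(s,d))$, the opposite cells $(r,d)$ and $(s,c)$ are not both in $O$; (C3) for each selected pair $((r,c),(s,d))$ (degenerate or not) and all $x\in[m]\setminus\{r,s\}$, $y\in[n]\setminus\{c,d\}$, at least one of the cells $(x,y),(x,c),(x,d),(r,y),(s,y)$ lies outside $O$. $z_A(m,n)$ is the maximum of $|E_1|+|E_2|$ over all admissible configurations. (These conditions are invariant under transposition, so $z_A(m,n)=z_A(n,m)$.) *)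

(* Defs.v *)
From mathcomp Require Import all_boot.
Set Implicit Arguments.
Unset Strict Implicit.
Unset Printing Implicit Defensive.

Notation cell m n := ('I_m * 'I_n)%type.

(* Indices are 0-based. *)
Definition C4_free (m n : nat) (A : {set cell m n}) : bool :=
  [forall r : 'I_m, forall s : 'I_m, forall c : 'I_n, forall d : 'I_n,
    (r != s) && (c != d) ==>
    ~~ [&& (r, c) \in A, (r, d) \in A, (s, c) \in A & (s, d) \in A]].

(* An unordered pair of distinct cells is a two-element set of cells, so that
   [set p; q] \in E2 says that E2 selects the pair with ends p and q. *)
Definition selected_pairs (m n : nat) (E1 : {set cell m n})
    (E2 : {set {set cell m n}}) : bool :=
  [forall e in E2, (#|e| == 2) && [disjoint e & E1]].

Definition occupied (m n : nat) (E1 : {set cell m n})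
    (E2 : {set {set cell m n}}) : {set cell m n} :=
  E1 :|: cover E2.

Definition cond_S (m n : nat) (E2 : {set {set cell m n}}) : bool :=
  trivIset E2.

(* The ends are (r, c) = p and (s, d) = q; nondegeneracy is the premise
   p.1 != q.1 and p.2 != q.2. *)
Definition cond_C2 (m n : nat) (E1 : {set cell m n})
    (E2 : {set {set cell m n}}) : bool :=
  [forall p : cell m n, forall q : cell m n,
    [&& [set p; q] \in E2, p.1 != q.1 & p.2 != q.2] ==>
    ~~ (((p.1, q.2) \in occupied E1 E2) && ((q.1, p.2) \in occupied E1 E2))].

(* Degenerate pairs are included, so p.1 = q.1 or p.2 = q.2 may hold. *)
Definition cond_C3 (m n : nat) (E1 : {set cell m n})
    (E2 : {set {set cell m n}}) : bool :=
  [forall p : cell m n, forall q : cell m n, forall x : 'I_m, forall y : 'I_n,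
    [&& [set p; q] \in E2, x != p.1, x != q.1, y != p.2 & y != q.2] ==>
    ~~ [&& (x, y) \in occupied E1 E2,
           (x, p.2) \in occupied E1 E2, (x, q.2) \in occupied E1 E2,
           (p.1, y) \in occupied E1 E2 & (q.1, y) \in occupied E1 E2]].

Definition admissible (m n : nat) (E1 : {set cell m n})
    (E2 : {set {set cell m n}}) : bool :=
  [&& C4_free E1, selected_pairs E1 E2,
      cond_S E2, cond_C2 E1 E2 & cond_C3 E1 E2].

(* The default 0 of \max is irrelevant: E1 = E2 = set0 is admissible. *)
Definition z_A (m n : nat) : nat :=
  \max_(E : {set cell m n} * {set {set cell m n}} | admissible E.1 E.2)
    (#|E.1| + #|E.2|).

(* Main.v *)
Require Import Defs.
From mathcomp Require Import all_boot all_order all_algebra.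
From mathcomp Require Import reals.
From mathcomp Require Import zify lra.
Import Order.TTheory GRing.Theory Num.Theory.

(** Three estimates give the result, with every error term of order at most
    sqrt (m * n * (m + n)), hence o(m * n) as soon as min (m, n) grows.

    The base is negligible: two rows of a C4-free set share at most one column,
    so by Cauchy-Schwarz the set has at most sqrt (m * n * (m + n)) cells
    ([C4_free_card]).

    Upper bound for the pairs ([card_pairs_le]).  Condition (C3) survives when
    occupied cells are deleted, so let O consist of the cells of the pairs only,
    and put D = #|O|.  Read O as a bipartite graph between rows and columns.
    Fix a column y of degree Q, write K c for the number of common neighbours of
    y and c, and let G, the sum of the K c, count the cells of O in the rows
    adjacent to y.  Call a pair inner if both of its cells lie in such rows
    and off the column y; let k be the number of cells of inner pairs.
    - Apart from the at most 2 * Q cells of pairs meeting column y, the cells in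
      rows adjacent to y that are not inner are matched with cells in the other
      rows, and there are D - G of those: 2 * G <= D + k + 2 * Q
      ([sum_common_rows_le]).
    - For an inner pair with columns c and d, (C3) says that y, c and d have no
      common neighbour outside the two rows of the pair, whence
      K c + K d <= Q + 2.  So inner cells sit on average in columns with
      K c at most half of Q + 2.  An elementary convexity argument turns this
      into k + G <= n * (Q + 2) ([inner_pairs_card]).
    Together 3 * G <= D + n * Q up to lower order terms.  Summed over y, the
    left side is three times the sum of the squared row degrees, at least
    3 * D ^ 2 / m by Cauchy-Schwarz, and the right side is 2 * n * D.  Therefore
    3 * D <= 2 * m * n up to O(m + n), and there are D / 2 pairs.

    Lower bound ([z_A_lower]).  Split rows and columns into three equal classes,
    occupy the cells whose row and column classes differ, and pair each cell
    of block (s, t) with a cell of block (t, s).  A row x and a column y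
    witnessing a failure of (C3) for such a pair would both be in the third
    class, but then (x, y) is not occupied. *)

Set Implicit Arguments.
Unset Strict Implicit.
Unset Printing Implicit Defensive.

(** * Sums of squares and C4-free sets *)

Section Counting.
Local Open Scope nat_scope.

Lemma sum_sqr_le (I : finType) (f : I -> nat) :
  (\sum_i f i) ^ 2 <= #|I| * \sum_i f i ^ 2.
Proof.
rewrite -(leq_pmul2l (isT : 0 < 2)).
have -> : (\sum_i f i) ^ 2 = \sum_i \sum_j f i * f j.
  by rewrite -mulnn big_distrl; apply: eq_bigr => i _; rewrite big_distrr.
have -> : 2 * (#|I| * \sum_i f i ^ 2) = \sum_i \sum_j (f i ^ 2 + f j ^ 2).
  under [RHS]eq_bigr do rewrite big_split /= sum_nat_const.
  by rewrite big_split /= sum_nat_const -big_distrr /= addnn mul2n.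
rewrite big_distrr; apply: leq_sum => i _.
by rewrite big_distrr; apply: leq_sum => j _; apply: nat_Cauchy.
Qed.

Lemma card_cells m n (A : {set cell m n}) :
  #|A| = \sum_r \sum_c ((r, c) \in A).
Proof.
rewrite -sum1_card big_mkcond pair_bigA /=.
by apply: eq_bigr => -[r c] _; case: ifP.
Qed.

(** The sum of the squared column degrees counts, for all pairs of rows, the
    columns they share: at most one for distinct rows, at most n for a row paired
    with itself. *)
Lemma C4_free_card m n (A : {set cell m n}) :
  C4_free A -> #|A| ^ 2 <= m * n * (m + n).
Proof.
move=> A_free; rewrite card_cells exchange_big /=.
apply: leq_trans (sum_sqr_le _) _; rewrite card_ord.
suff: \sum_(c < n) (\sum_(r < m) ((r, c) \in A)) ^ 2 <= m * m + m * n.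
  move: (\sum_c _) => X; rewrite -mulnDr [m * n]mulnC -mulnA leq_mul2l.
  by move=> ->; rewrite orbT.
have -> : \sum_(c < n) (\sum_(r < m) ((r, c) \in A)) ^ 2 =
    \sum_(r < m) \sum_(s < m) \sum_(c < n) ((r, c) \in A) * ((s, c) \in A).
  under eq_bigr => c _.
    rewrite -mulnn big_distrl; under eq_bigr do rewrite big_distrr; over.
  by rewrite exchange_big; apply: eq_bigr => r _; rewrite exchange_big.
have bound r s : \sum_(c < n) ((r, c) \in A) * ((s, c) \in A) <=
    1 + n * (r == s).
  have [->|neq_rs] := eqVneq r s.
    rewrite muln1 -[X in 1 + X]card_ord -sum1_card ltnW // ltnS.
    by apply: leq_sum => c _; case: (_ \in A).
  rewrite muln0 addn0.
  have -> : \sum_(c < n) ((r, c) \in A) * ((s, c) \in A) =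
      #|[set c | ((r, c) \in A) && ((s, c) \in A)]|.
    rewrite -sum1_card [RHS]big_mkcond; apply: eq_bigr => c _; rewrite inE.
    by do 2!case: (_ \in A).
  apply/card_le1_eqP => d c; rewrite !inE => /andP[rdA sdA] /andP[rcA scA].
  apply/eqP/negPn/negP => neq_cd.
  move/forallP/(_ r)/forallP/(_ s)/forallP/(_ c)/forallP/(_ d): A_free.
  by rewrite neq_rs neq_cd rcA scA rdA sdA.
apply: leq_trans (_ : \sum_(r < m) \sum_(s < m) (1 + n * (r == s)) <= _).
  by apply: leq_sum => r _; apply: leq_sum => s _; apply: bound.
apply: eq_leq; rewrite -[in RHS]mulnDr -[X in _ = X * _](card_ord m) -sum_nat_const.
apply: eq_bigr => r _; rewrite big_split /= sum1_card card_ord -big_distrr /=.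
congr (_ + _); rewrite (bigD1 r) //= eqxx big1 ?addn0 ?muln1 // => s.
by rewrite eq_sym => /negPf ->.
Qed.

End Counting.

(** * Upper bound for the number of pairs *)

Section UpperBound.
Local Open Scope nat_scope.
Variables (m n : nat) (E2 : {set {set cell m n}}).
Hypothesis E2_card2 : forall e, e \in E2 -> #|e| = 2.
Hypothesis E2_triv : trivIset E2.
Let O := cover E2.
Hypothesis E2_C3 : forall (p q : cell m n) (x : 'I_m) (y : 'I_n),
  [set p; q] \in E2 -> x != p.1 -> x != q.1 -> y != p.2 -> y != q.2 ->
  ~~ [&& (x, y) \in O, (x, p.2) \in O, (x, q.2) \in O,
         (p.1, y) \in O & (q.1, y) \in O].

Lemma card_cover_pairs (I : {set {set cell m n}}) :
  I \subset E2 -> #|cover I| = #|I| * 2.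
Proof.
move=> sIE; rewrite -(eqP (trivIsetS sIE E2_triv)) -sum_nat_const.
by apply: eq_bigr => e /(subsetP sIE)/E2_card2.
Qed.

Definition common_rows (y c : 'I_n) :=
  [set r | ((r, c) \in O) && ((r, y) \in O)].

(** For these pairs (C3), taken at the column y, becomes a condition on column
    neighbourhoods alone: y differs from both columns of the pair, and the cells
    of column y in the two rows of the pair are occupied. *)
Definition inner_pairs (y : 'I_n) :=
  [set e in E2 | [forall u in e, ((u.1, y) \in O) && (u.2 != y)]].

Lemma inner_pairs_sub y : inner_pairs y \subset E2.
Proof. by apply/subsetP => e; rewrite inE => /andP[]. Qed.

(** By (C3) the common neighbours of y, p.2 and q.2 are among the rows of the
    pair itself, so the two sets of common rows, both inside the neighbourhood of
    y, overlap in at most two rows. *)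
Lemma inner_pair_common y e : e \in inner_pairs y ->
  \sum_(u in e) #|common_rows y u.2| <= #|common_rows y y| + 2.
Proof.
rewrite inE => /andP[eE /forall_inP e_in].
have /eqP/cards2P[p [q [neq_pq def_e]]] := E2_card2 eE.
rewrite def_e big_setU1 ?inE //= big_set1 -cardsUI leq_add //.
  apply: subset_leq_card; apply/subsetP => r; rewrite !inE.
  by case/orP => /andP[_ ->].
apply: leq_trans (_ : #|[set p.1; q.1]| <= 2); last by rewrite cards2; case: eqP.
apply: subset_leq_card; apply/subsetP => x.
rewrite !inE => /andP[/andP[xp xy] /andP[xq _]].
have /andP[py yp] : ((p.1, y) \in O) && (p.2 != y).
  by apply: e_in; rewrite def_e set21.
have /andP[qy yq] : ((q.1, y) \in O) && (q.2 != y).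
  by apply: e_in; rewrite def_e set22.
apply/negPn/negP; rewrite negb_or => /andP[xNp xNq].
have pqE : [set p; q] \in E2 by rewrite -def_e.
rewrite eq_sym in yp; rewrite eq_sym in yq.
have := E2_C3 pqE xNp xNq yp yq.
by rewrite xp xy xq py qy.
Qed.

(** The left side minus the right side is affine in k; at k = 0 it is
    - Q * (Q - K) and at k = K it is - (Q - 2 * K) ^ 2.  The slope is chosen so
    that the second value is a square. *)
Lemma quadratic_bound k K Q : k <= K -> K <= Q ->
  3 * Q * k + Q * K <= Q ^ 2 + 4 * (k * K).
Proof.
move=> le_kK le_KQ; have := (nat_Cauchy Q (2 * K)).1.
have [le_QK|lt_KQ] := leqP (3 * Q) (4 * K); first nia.
(* The difference is (Q - 2 * K) ^ 2 + (K - k) * (3 * Q - 4 * K). *)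
have : 0 <= (K - k) * (3 * Q - 4 * K) by [].
rewrite -!mulnn; nia.
Qed.

(** Weighted by the number of inner cells per column, the average of
    #|common_rows y c| is at most Q / 2 where Q = #|common_rows y y| + 2, by
    [inner_pair_common].  Columns with many common rows thus carry few inner
    cells; [quadratic_bound], summed over the columns, makes this precise. *)
Lemma inner_pairs_card y :
  #|inner_pairs y| * 2 + \sum_c #|common_rows y c| <=
  n * (#|common_rows y y| + 2).
Proof.
set Q := #|common_rows y y| + 2; set k := #|inner_pairs y| * 2.
pose kc c := \sum_r ((r, c) \in cover (inner_pairs y)).
have sum_kc : \sum_c kc c = k.
  by rewrite /k -(card_cover_pairs (inner_pairs_sub y)) card_cells exchange_big.
have kc_le c : kc c <= #|common_rows y c|.
  rewrite -sum1_card [leqRHS]big_mkcond; apply: leq_sum => r _ /=.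
  case: bigcupP => // -[e eI rce]; suff -> : r \in common_rows y c by [].
  move: eI; rewrite !inE => /andP[eE /forall_inP/(_ _ rce)/andP[-> _]].
  by rewrite andbT; apply/bigcupP; exists e.
have common_le c : #|common_rows y c| <= Q.
  apply: leq_trans (leq_addr _ _); apply: subset_leq_card.
  by apply/subsetP => r; rewrite !inE => /andP[_ ->].
have sum_kK : (\sum_c kc c * #|common_rows y c|) * 2 <= Q * k.
  have -> : \sum_c kc c * #|common_rows y c| =
      \sum_(u in cover (inner_pairs y)) #|common_rows y u.2|.
    under eq_bigr do rewrite big_distrl /=.
    rewrite exchange_big pair_bigA [RHS]big_mkcond.
    by apply: eq_bigr => -[r c] _ /=; case: ifP => _; rewrite ?mul1n ?mul0n.
  rewrite big_trivIset ?(trivIsetS (inner_pairs_sub y)) //= /k.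
  rewrite mulnA leq_mul2r /= mulnC -sum_nat_const.
  by apply: leq_sum => e; apply: inner_pair_common.
have : \sum_c (3 * Q * kc c + Q * #|common_rows y c|) <=
    \sum_(c < n) (Q ^ 2 + 4 * (kc c * #|common_rows y c|)).
  by apply: leq_sum => c _; apply: quadratic_bound.
rewrite 2!big_split /= sum_nat_const card_ord -!big_distrr /= sum_kc.
move: sum_kK.
have : 0 < Q by rewrite addn_gt0 orbT.
move: (\sum_c kc c * #|common_rows y c|) (\sum_c #|common_rows y c|) => S G.
clearbody Q k => Q_gt0 leS leT; rewrite -(leq_pmul2l Q_gt0).
lia.
Qed.

Lemma sum_common_rows y :
  \sum_c #|common_rows y c| = \sum_(u in O) ((u.1, y) \in O).
Proof.
have -> : \sum_c #|common_rows y c| =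
    \sum_c \sum_r (((r, c) \in O) && ((r, y) \in O)).
  apply: eq_bigr => c _; rewrite -sum1_card big_mkcond.
  by apply: eq_bigr => r _; rewrite inE; case: (_ && _).
rewrite exchange_big pair_bigA [RHS]big_mkcond.
by apply: eq_bigr => -[r c] _ /=; case: ifP.
Qed.

(** It suffices to compare the two sides pair by pair: a pair with both cells in
    rows adjacent to y is inner, unless one of its cells lies in column y. *)
Lemma sum_common_rows_le y :
  2 * \sum_c #|common_rows y c| <=
  #|O| + #|inner_pairs y| * 2 + 2 * #|common_rows y y|.
Proof.
have -> : #|common_rows y y| = \sum_(u in O) ((u.1, y) \in O) * (u.2 == y).
  rewrite [RHS]big_mkcond /=.
  have -> : #|common_rows y y| =
      \sum_r \sum_c (((r, c) \in O) && ((r, y) \in O) && (c == y)).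
    rewrite -sum1_card big_mkcond; apply: eq_bigr => r _.
    rewrite [RHS](bigD1 y) //= eqxx big1 => [|c /negPf->]; last by rewrite andbF.
    by rewrite inE andbT addn0; case: (_ && _).
  rewrite pair_bigA; apply: eq_bigr => -[r c] _ /=.
  by case: ifP; rewrite ?mulnb.
rewrite sum_common_rows !big_trivIset // card_cover_pairs // -sum_nat_const.
have -> : #|inner_pairs y| * 2 = \sum_(e in E2) (e \in inner_pairs y) * 2.
  rewrite -big_distrl -sum1_card big_mkcond [in RHS]big_mkcond; congr (_ * _).
  apply: eq_bigr => e _.
  case: (boolP (e \in inner_pairs y)) => [/(subsetP (inner_pairs_sub y))->|_] //.
  by case: ifP.
rewrite !big_distrr -!big_split; apply: leq_sum => e eE.
have /eqP/cards2P[p [q [neq_pq def_e]]] := E2_card2 eE.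
rewrite inE eE /=.
have -> : [forall u in e, ((u.1, y) \in O) && (u.2 != y)] =
    [&& ((p.1, y) \in O) && (p.2 != y) & ((q.1, y) \in O) && (q.2 != y)].
  apply/forall_inP/andP => [all_e|[p_in q_in] u].
    by split; apply: all_e; rewrite def_e ?set21 ?set22.
  by rewrite def_e !inE => /orP[]/eqP->.
rewrite def_e !big_setU1 ?inE //= !big_set1.
by case: (_ \in O); case: (_ \in O); do 2!case: (_ == y).
Qed.

Lemma sum_row_degree_sqr :
  \sum_y \sum_c #|common_rows y c| = \sum_r (\sum_c ((r, c) \in O)) ^ 2.
Proof.
have -> : \sum_r (\sum_c ((r, c) \in O)) ^ 2 =
    \sum_y \sum_c \sum_r ((r, c) \in O) * ((r, y) \in O).
  under eq_bigr => r _.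
    rewrite -mulnn big_distrr; under eq_bigr do rewrite big_distrl; over.
  by rewrite exchange_big; apply: eq_bigr => y _; rewrite exchange_big.
apply: eq_bigr => y _; apply: eq_bigr => c _.
rewrite -sum1_card big_mkcond; apply: eq_bigr => r _.
by rewrite inE mulnb; case: (_ && _).
Qed.

Lemma sum_col_degree : \sum_y #|common_rows y y| = #|O|.
Proof.
rewrite card_cells exchange_big; apply: eq_bigr => y _ /=.
rewrite -sum1_card big_mkcond; apply: eq_bigr => r _.
by rewrite inE andbb; case: (_ \in O).
Qed.

(** Adding [inner_pairs_card] and [sum_common_rows_le] eliminates the inner
    pairs and bounds the number of occupied cells in rows adjacent to y; summed
    over y, that number becomes the sum of the squared row degrees, which is at
    least its value for equal degrees. *)
Lemma card_pairs_le : 6 * #|E2| <= 2 * (m * n) + 3 * (m + n).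
Proof.
have DE : #|O| = #|E2| * 2 by apply: card_cover_pairs.
have : \sum_y 3 * \sum_c #|common_rows y c| <=
    \sum_y (#|O| + (n + 2) * #|common_rows y y| + 2 * n).
  apply: leq_sum => y _.
  have := inner_pairs_card y; have := sum_common_rows_le y; lia.
rewrite !big_split -!big_distrr /= sum_col_degree sum_row_degree_sqr.
rewrite !sum_nat_const card_ord.
have := sum_sqr_le (fun r : 'I_m => \sum_c ((r, c) \in O)).
rewrite -card_cells card_ord; move: (\sum_r _) => S.
have : #|O| <= m * n by rewrite (leq_trans (max_card _)) // card_prod !card_ord.
rewrite DE; move defD: (#|E2| * 2) => D leD leS le3.
have -> : 6 * #|E2| = 3 * D by rewrite -defD mulnCA mulnC.
have [D_le|D_gt] := leqP (3 * D) (2 * (m * n)); first lia.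
(* Up to here 3 * D ^ 2 <= m * (2 * n * D + 2 * D + 2 * n ^ 2); the last term
   is absorbed by 2 * m * n < 3 * D. *)
have : D * (3 * D) <= D * (2 * (m * n) + 3 * (m + n)) by nia.
rewrite leq_mul2l; lia.
Qed.

End UpperBound.

(** * The three-class construction *)

Section LowerBound.
Local Open Scope nat_scope.
Variables m n : nat.

Lemma triple_lt_proof k (i : 'I_(k %/ 3)) (t : nat) : 3 * i + t %% 3 < k.
Proof. by have := ltn_ord i; lia. Qed.

(** Index classes are residues modulo 3; reducing t in the formula lets the class
    after t be written t.+1. *)
Definition triple_index k (i : 'I_(k %/ 3)) (t : nat) : 'I_k :=
  Ordinal (triple_lt_proof i t).

Definition block_cell (i : 'I_(m %/ 3)) (j : 'I_(n %/ 3)) (s t : nat) : cell m n :=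
  (triple_index i s, triple_index j t).

Definition block_pair (ijt : 'I_(m %/ 3) * 'I_(n %/ 3) * 'I_3) :=
  let: (i, j, t) := ijt in
  [set block_cell i j t t.+1; block_cell i j t.+1 t].

Definition block_pairs := [set block_pair ijt | ijt in setT].

Lemma card_block_pair ijt : #|block_pair ijt| = 2.
Proof.
case: ijt => [[i j] t]; rewrite cards2 xpair_eqE -val_eqE /=; case: eqP => //; lia.
Qed.

Lemma block_pair_inj ijt ijt' (u : cell m n) :
  u \in block_pair ijt -> u \in block_pair ijt' -> ijt = ijt'.
Proof.
case: ijt ijt' => [[i j] t] [[i' j'] t'].
rewrite !inE => /orP[]/eqP-> /orP[]; rewrite xpair_eqE -!val_eqE /=.
all: move=> /andP[/eqP eq1 /eqP eq2].
all: have := ltn_ord t; have := ltn_ord t' => lt' lt.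
all: congr (_, _, _); apply: val_inj => /=; lia.
Qed.

Lemma block_pairs_triv : trivIset block_pairs.
Proof.
apply/trivIsetP => e e' /imsetP[x _ ->] /imsetP[x' _ ->] neq_e.
apply/pred0P => u /=; apply/negP => /andP[ux ux'].
by rewrite (block_pair_inj ux ux') eqxx in neq_e.
Qed.

Lemma card_block_pairs : #|block_pairs| = 3 * (m %/ 3 * (n %/ 3)).
Proof.
have pair_inj : injective block_pair.
  move=> x x' eq_x.
  have /card_gt0P[u ux] : 0 < #|block_pair x| by rewrite card_block_pair.
  by apply: (block_pair_inj ux); rewrite -eq_x.
by rewrite card_imset // cardsT !card_prod !card_ord mulnC.
Qed.

Lemma block_pairs_mod (p q : cell m n) : [set p; q] \in block_pairs ->
  [/\ p.1 != p.2 %[mod 3], q.1 = p.2 %[mod 3] & q.2 = p.1 %[mod 3]].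
Proof.
case/imsetP=> -[[i j] t] _ def_pq.
have neq_pq : p != q.
  by have := card_block_pair (i, j, t); rewrite -def_pq cards2; case: eqP.
have := set21 p q; have := set22 p q; rewrite def_pq !inE.
move: neq_pq => /[swap]/orP[]/eqP-> /[swap]/orP[]/eqP->; rewrite ?eqxx //= => _.
all: split; lia.
Qed.

(** This is all that (C2) and (C3) need: opposite cells of a pair lie in
    diagonal blocks, and so does (x, y) when x and y avoid both classes of the
    pair. *)
Lemma cover_block_pairs (u : cell m n) :
  u \in cover block_pairs -> u.1 != u.2 %[mod 3].
Proof.
case/bigcupP => e /[dup] eE /imsetP[x _ def_e] ue.
have /eqP/cards2P[p [q [_ def_pq]]] := card_block_pair x.
move: ue eE; rewrite def_e def_pq => /set2P[]-> /block_pairs_mod[//].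
by move=> + -> ->; rewrite eq_sym.
Qed.

Lemma block_pairs_admissible : admissible set0 block_pairs.
Proof.
have occE : occupied set0 block_pairs = cover block_pairs by apply: set0U.
apply/and5P; split.
- by do 4!apply/forallP => ?; rewrite !inE; apply/implyP.
- apply/forall_inP => e /imsetP[x _ ->]; rewrite card_block_pair /=.
  by rewrite disjoint_sym; apply/pred0P => u; rewrite /= inE.
- exact: block_pairs_triv.
- apply/forallP => p; apply/forallP => q; apply/implyP => /and3P[pqE _ _].
  rewrite occE; apply/negP => /andP[/cover_block_pairs /=].
  by have [_ _ ->] := block_pairs_mod pqE; rewrite eqxx.
apply/forallP => p; apply/forallP => q; apply/forallP => x; apply/forallP => y.
apply/implyP => /and5P[pqE _ _ _ _]; rewrite occE; apply/negP.
case/and5P => /cover_block_pairs/= xy /cover_block_pairs/= xp.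
move=> /cover_block_pairs/= xq /cover_block_pairs/= py /cover_block_pairs/= qy.
have [] := block_pairs_mod pqE; lia.
Qed.

Lemma z_A_lower : m * n <= 3 * z_A m n + 2 * (m + n).
Proof.
have : 3 * (m %/ 3 * (n %/ 3)) <= z_A m n.
  rewrite -card_block_pairs -[#|_|]add0n -(@cards0 (cell m n)).
  exact: (leq_bigmax_cond (set0, block_pairs)) block_pairs_admissible.
have := divn_eq m 3; have := divn_eq n 3.
have := ltn_pmod m (isT : 0 < 3); have := ltn_pmod n (isT : 0 < 3).
nia.
Qed.

End LowerBound.

(** * The asymptotic value *)

Lemma admissible_pairs_le m n (E1 : {set cell m n}) E2 :
  admissible E1 E2 -> (6 * #|E2| <= 2 * (m * n) + 3 * (m + n))%N.
Proof.
case/and5P => _ /forall_inP selE triE _ C3; apply: card_pairs_le => //.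
  by move=> e /selE/andP[/eqP].
move=> p q x y pqE xp xq yp yq.
move/forallP/(_ p)/forallP/(_ q)/forallP/(_ x)/forallP/(_ y): C3.
rewrite pqE xp xq yp yq /=; apply: contra.
by rewrite !(inE, in_setU) => /and5P[-> -> -> -> ->]; rewrite !orbT.
Qed.

Lemma z_A_attained m n :
  exists2 E : {set cell m n} * {set {set cell m n}},
    admissible E.1 E.2 & z_A m n = (#|E.1| + #|E.2|)%N.
Proof.
have [|E Eadm zE] := @eq_bigmax_cond _
  (fun E : {set cell m n} * {set {set cell m n}} => admissible E.1 E.2)
  (fun E => #|E.1| + #|E.2|)%N; last by exists E.
by apply/card_gt0P; exists (set0, block_pairs m n); apply: block_pairs_admissible.
Qed.

Local Open Scope ring_scope.

Theorem theorem4 (R : realType) (eps : R) (eps_gt0 : 0 < eps) :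
  exists N : nat, forall m n : nat,
    (2 <= m)%N -> (2 <= n)%N -> (N <= minn m n)%N ->
    `| (z_A m n)%:R - (m * n)%:R / 3%:R | <= eps * (m * n)%:R.
Proof.
(* The first bound makes m + n <= eps * m * n, the second makes the square root
   bound on the base at most eps / 2 * m * n. *)
pose N := (Num.bound (2 / eps) + Num.bound (8 / eps ^+ 2)).+1.
exists N => m n m_ge2 n_ge2; rewrite leq_min => /andP[le_Nm le_Nn].
have N_gt0 : 0 < N%:R :> R by rewrite ltr0n.
have le_N1 : 2 <= eps * N%:R.
  rewrite mulrC -ler_pdivrMr //; apply: ltW.
  apply: lt_le_trans (archi_boundP _) _; first by rewrite divr_ge0 // ltW.
  by rewrite ler_nat leqW // leq_addr.
have le_N2 : 8 <= eps ^+ 2 * N%:R.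
  rewrite mulrC -ler_pdivrMr ?exprn_gt0 //; apply: ltW.
  apply: lt_le_trans (archi_boundP _) _; first by rewrite divr_ge0 ?exprn_ge0 // ltW.
  by rewrite ler_nat leqW // leq_addl.
set S := (m * n)%:R; set d : R := (m + n)%:R.
have S_ge0 : 0 <= S by [].
have d_ge0 : 0 <= d by [].
have le_dN : N%:R * d <= 2 * S.
  by rewrite -!natrM ler_nat; nia.
have le_d : d <= eps * S.
  by rewrite -(ler_pM2l N_gt0) (le_trans le_dN) // mulrA ler_wpM2r // mulrC.
have le_d2 : 4 * d <= eps ^+ 2 * S.
  rewrite -(ler_pM2l N_gt0); have := ler_wpM2r S_ge0 le_N2; lra.
rewrite ler_norml; apply/andP; split.
  have : S <= 3 * (z_A m n)%:R + 2 * d.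
    by rewrite -!natrM -natrD ler_nat z_A_lower.
  lra.
have [E Eadm ->] := z_A_attained m n.
have le_E2 : 6 * #|E.2|%:R <= 2 * S + 3 * d.
  by rewrite -!natrM -natrD ler_nat (admissible_pairs_le Eadm).
have le_E1 : 2 * #|E.1|%:R <= eps * S.
  have /and5P[E1_free _ _ _ _] := Eadm.
  rewrite -(@ler_pXn2r _ 2) ?nnegrE ?mulr_ge0 ?(ltW eps_gt0) // !exprMn.
  have : #|E.1|%:R ^+ 2 <= S * d :> R.
    by rewrite -natrX -natrM ler_nat C4_free_card.
  have := ler_wpM2r S_ge0 le_d2; lra.
rewrite natrD; lra.
Qed.
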